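(* If $K/\mathbb{Q}$ is a totally imaginary quartic number field, then all elements in $K$ are preperiodic under iteration of the Mahler measure $M$.
   Context: Fix an algebraic closure $\overline{\mathbb{Q}}\subseteq\mathbb{C}$ of $\mathbb{Q}$; number fields are subfields of $\overline{\mathbb{Q}}$. For $\alpha\in\overline{\mathbb{Q}}$ with (primitive) minimal polynomial $f(x)=a_nx^n+\cdots+a_0=a_n(x-\alpha_1)\cdots(x-\alpha_n)\in\mathbb{Z}[x]$ (so $f$ is irreducible in $\mathbb{Z}[x]$), the Mahler measure of $\alpha$ is $M(\alpha)=|a_n|\prod_{i=1}^n\max\{1,|\alpha_i|\}$. This is again an algebraic number, so $M$ is a map $\overline{\mathbb{Q}}\to\overline{\mathbb{Q}}$. Put $M^0(\alpha)=\alpha$ and $M^n(\alpha)=M(M^{n-1}(\alpha))$ for $n\ge1$. The point $\alpha$ is preperiodic (under iteration of $M$) if its forward orbit $\{M^n(\alpha):n\ge0\}$ is finite. *)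

(* Defs.v *)
From mathcomp Require Import all_boot all_order all_algebra all_field.

Set Implicit Arguments.
Unset Strict Implicit.
Unset Printing Implicit Defensive.

Import Order.TTheory GRing.Theory Num.Theory.
Local Open Scope ring_scope.

Definition ZirrPoly (f : {poly int}) : Prop :=
  [/\ f != 0, f \isn't a GRing.unit
    & forall g h, f = g * h -> g \is a GRing.unit \/ h \is a GRing.unit].

(* The primitive minimal polynomial: clear the denominators of the monic
   minimal polynomial over the rationals and divide by the content.
   Of the two associates f and -f, zprimitive selects the one with positive
   leading coefficient. *)
Definition zminpoly (x : algC) : {poly int} :=
  zprimitive (projT1 (rat_poly_scale (sval (minCpolyP x)))).

(* The roots with multiplicity, as a sequence. *)
Definition conjugates (x : algC) : seq algC :=
  sval (closed_field_poly_normal (map_poly intr (zminpoly x) : {poly algC})).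

Definition mahler (x : algC) : algC :=
  `|(lead_coef (zminpoly x))%:~R| * \prod_(z <- conjugates x) Num.max 1 `|z|.

Definition preperiodic (T : eqType) (f : T -> T) (x : T) : Prop :=
  exists s : seq T, forall n, iter n f x \in s.

(* K is algebraic over the rationals, so its complex embeddings are exactly its
   ring morphisms to algC; y \is Num.real means that y is a real number. *)
Definition totally_imaginary (K : fieldExtType rat) : Prop :=
  forall sigma : {rmorphism K -> algC}, ~ (forall y, sigma y \is Num.real).


Lemma zminpoly_scale (x : algC) :
  exists2 c : rat, c != 0 & sval (minCpolyP x) = c *: map_poly intr (zminpoly x).
Proof.
rewrite /zminpoly; case: (rat_poly_scale _) => p [a nza Dq] /=.
have nzq: sval (minCpolyP x) != 0.
  by case: (minCpolyP x) => q /= [_ mon_q _]; apply: monic_neq0.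
have /= Dp := zpolyEprim p.
exists (a%:~R^-1 * (zcontents p)%:~R).
  rewrite mulf_neq0 ?invr_eq0 ?intr_eq0 // zcontents_eq0.
  by apply: contraNneq nzq => p0; rewrite Dq p0 rmorph0 scaler0.
by apply: (etrans Dq); rewrite {1}Dp map_polyZ scalerA.
Qed.

Lemma zminpoly_neq0 (x : algC) : zminpoly x != 0.
Proof.
have [c _ Dq] := zminpoly_scale x.
case: (minCpolyP x) Dq => q /= [_ mon_q _] Dq.
by apply: contraTneq (monic_neq0 mon_q) => z0; rewrite Dq z0 rmorph0 scaler0 eqxx.
Qed.

Lemma zcontents_zminpoly (x : algC) : zcontents (zminpoly x) = 1.
Proof.
have := zminpoly_neq0 x; rewrite /zminpoly zprimitive_eq0 => nz.
by rewrite zcontents_primitive nz.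
Qed.

Lemma root_zint (p : {poly int}) (x : algC) :
  root (map_poly intr p) x = (sval (minCpolyP x) %| map_poly intr p)%R.
Proof.
case: (minCpolyP x) => q /= [_ _ <-]; congr (root _ x).
by rewrite -map_poly_comp; apply: eq_map_poly => z /=; rewrite ratr_int.
Qed.

Lemma root_zminpoly (x : algC) : root (map_poly intr (zminpoly x)) x.
Proof.
rewrite root_zint; have [c nzc ->] := zminpoly_scale x.
by rewrite dvdpZl.
Qed.

Lemma zminpoly_dvd (p : {poly int}) (x : algC) :
  root (map_poly intr p) x -> exists r, p = zminpoly x * r.
Proof.
rewrite root_zint; have [c nzc ->] := zminpoly_scale x; rewrite dvdpZl //.
rewrite dvdp_rat_int => /dvdpP_int[r ->]; exists r.
by rewrite /zminpoly zprimitive_id.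
Qed.

Lemma size_zminpoly (x : algC) : (1 < size (zminpoly x))%N.
Proof.
have := root_size_gt1 _ (root_zminpoly x).
rewrite map_poly_eq0_id0 ?zminpoly_neq0 ?intr_eq0 ?lead_coef_eq0 ?zminpoly_neq0 //.
rewrite size_map_inj_poly //; last exact: intr_inj.
exact.
Qed.

Lemma zminpoly_irr (x : algC) : ZirrPoly (zminpoly x).
Proof.
split; first exact: zminpoly_neq0.
  rewrite poly_unitE; have := size_zminpoly x.
  by case: eqP => // ->.
suff factor g h : zminpoly x = g * h -> root (map_poly intr g) x ->
    h \is a GRing.unit.
  move=> g h Df; have := root_zminpoly x; rewrite Df rmorphM rootM.
  case/orP=> [/(factor g h Df) | rh]; first by right.
  by left; apply: (factor h g); rewrite // mulrC.
move=> Df /zminpoly_dvd[r Dg].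
have: zminpoly x * (r * h) = zminpoly x * 1 by rewrite mulrA -Dg -Df mulr1.
move/(mulfI (zminpoly_neq0 x)) => rh1.
by apply/unitrPr; exists r; rewrite mulrC.
Qed.

(* The value of the Mahler measure does not depend on the choices above. *)
Lemma mahlerE (x : algC) (f : {poly int}) (s : seq algC) :
    ZirrPoly f -> root (map_poly intr f) x ->
    map_poly intr f = (lead_coef f)%:~R *: \prod_(z <- s) ('X - z%:P) ->
  mahler x = `|(lead_coef f)%:~R| * \prod_(z <- s) Num.max 1 `|z|.
Proof.
move=> [nzf _ irrf] /zminpoly_dvd[r Df] Ds.
have [_ nuz _] := zminpoly_irr x.
have [/(negP nuz) // | ur] := irrf _ _ Df.
move: ur; rewrite poly_unitE => /andP[/size_poly1P[c nzc Dr]].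
rewrite {}Dr in Df *; rewrite coefC /= => uc.
have lf : lead_coef f = lead_coef (zminpoly x) * c.
  by rewrite Df lead_coefM lead_coefC.
have nc : `|c%:~R : algC| = 1.
  by move: uc; rewrite qualifE /= => /orP[]/eqP->; rewrite ?rmorphN1 ?normrN1 ?normr1.
rewrite /mahler lf rmorphM normrM nc mulr1; congr (_ * _).
apply: perm_big; rewrite /conjugates.
case: closed_field_poly_normal => t /=.
rewrite lead_coef_map_inj //; last exact: intr_inj.
move=> Dt; apply: prod_XsubC_eq.
have nzl : (lead_coef f)%:~R != 0 :> algC by rewrite intr_eq0 lead_coef_eq0.
apply: (scalerI nzl); rewrite -Ds Df rmorphM /= map_polyC /= -Df lf rmorphM.
by rewrite [RHS]mulrC mul_polyC [_ * c%:~R]mulrC -scalerA -Dt.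
Qed.

(* Main.v *)
From HB Require Import structures.
Require Import Defs.
From mathcomp Require Import all_boot all_order all_algebra all_field.

Set Implicit Arguments.
Unset Strict Implicit.
Unset Printing Implicit Defensive.

Import Order.TTheory GRing.Theory Num.Theory.
Local Open Scope ring_scope.

(** Write M(x) = |a| * prod max(1, |z|), the product running over the conjugates
    z of x, where a is the leading coefficient of the primitive minimal
    polynomial.  If no conjugate lies strictly inside the unit disc, M(x) is the
    absolute value of the constant coefficient; if none lies strictly outside,
    M(x) = |a|.  Both are natural numbers, and a natural number is preperiodic
    since M sends it to itself, or to 1 if it is 0 ([preperiodic_nat]).

    For x in a totally imaginary quartic field the degree is 1, 2 or 4, and in
    degree 4 the conjugates form two complex conjugate pairs.  So the only cases
    left are one real conjugate outside and one inside (degree 2), or one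
    conjugate pair outside and one inside (degree 4).  In both cases M(x) = g
    with g = |a * prod of the outer conjugates|.  Put
    g' = +- a * prod of the inner conjugates and m = |g g'|, a positive integer
    because it is |a| times the absolute value of the constant coefficient.
    Every automorphism moves g to g, to g', or, when it mixes the two pairs, to
    a number of modulus sqrt m ([preperiodic_split]).  Also g is an algebraic
    integer, as a times a product of roots always is ([Aint_prod_roots]).

    The theorem thus follows from [preperiodic_reciprocal], which treats such a
    number g.  If |g'| >= 1 or g' is not a conjugate of g, then M(g) is a
    natural number.  Otherwise let k conjugates have modulus sqrt m; the norm of g shows
    that C = (sqrt m)^k = |norm g| / m is an integer.  For an integer c > 0 the
    number c g has the conjugates c g, c g' and k others of modulus c sqrt m, so
    as long as c |g'| < 1, M(c g) = c^(k+1) C g.  The orbit of g thus consists of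
    integer multiples c g with c nondecreasing: either c becomes stationary and
    the orbit is constant from there on, or c grows until c |g'| >= 1, at which
    point no conjugate is left inside the unit disc and the next term is a
    natural number.

    Conjugates are handled throughout as the images under automorphisms of the
    field of algebraic numbers ([mem_conjugatesP]), which replaces Galois groups,
    and as a sequence without repetition ([conjugates_uniq]). *)

Local Notation zlead x := (lead_coef (zminpoly x))%:~R.

(** * Conjugates as images under automorphisms *)

Lemma map_ratr_intr (p : {poly int}) :
  map_poly ratr (map_poly intr p : {poly rat}) = map_poly intr p :> {poly algC}.
Proof.
by rewrite -map_poly_comp; apply: eq_map_poly => z /=; rewrite ratr_int.
Qed.

Lemma zminpoly_factor (x : algC) :
  map_poly intr (zminpoly x) =
    zlead x *: \prod_(z <- conjugates x) ('X - z%:P).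
Proof.
rewrite /conjugates; case: closed_field_poly_normal => s /=.
by rewrite lead_coef_map_inj //; apply: intr_inj.
Qed.

Lemma minCpoly_conjugates (x : algC) :
  minCpoly x = \prod_(z <- conjugates x) ('X - z%:P).
Proof.
have [c nzc Dq] := zminpoly_scale x; have Dz := zminpoly_factor x.
case: (minCpolyP x) Dq => q /= [-> mon_q _] Dq.
have Dq': map_poly ratr q =
    (ratr c * zlead x : algC) *:
      \prod_(z <- conjugates x) ('X - z%:P).
  by rewrite Dq map_polyZ /= map_ratr_intr Dz scalerA.
have := congr1 lead_coef Dq'.
rewrite lead_coefZ (monicP (monic_prod_XsubC _ _ _)) mulr1 lead_coef_map.
rewrite (monicP mon_q) rmorph1 => c1.
by rewrite Dq' -c1 scale1r.
Qed.

Lemma conjugate_refl (x : algC) : x \in conjugates x.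
Proof. by rewrite -root_prod_XsubC -minCpoly_conjugates root_minCpoly. Qed.

Lemma map_poly_in_alg (K : fieldExtType rat) (sigma : {rmorphism K -> algC})
    (q : {poly rat}) :
  map_poly sigma (map_poly (in_alg K) q) = map_poly ratr q.
Proof.
rewrite -map_poly_comp; apply: eq_map_poly => a.
by rewrite /= rmorphZ_num rmorph1 mulr1.
Qed.

(** The number field generated by the conjugates of x is a splitting field, so
    an element of its Galois group moves x to y; it extends to all of algC. *)
Lemma aut_of_conjugate (x y : algC) :
  y \in conjugates x -> exists nu : {rmorphism algC -> algC}, nu x = y.
Proof.
move=> xy; have [Q [QC [s Ds genQ]]] := num_field_exists (conjugates x).
have [p [Dp mon_p] dv_p] := minCpolyP x.
have Fs : map_poly (in_alg Q) p = \prod_(z <- s) ('X - z%:P).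
  apply/(map_poly_inj QC); rewrite (map_poly_in_alg QC) -Dp minCpoly_conjugates -Ds.
  rewrite big_map rmorph_prod /=; apply: eq_bigr => z _.
  by rewrite map_polyXsubC.
have Qp : map_poly (in_alg Q) p \is a polyOver 1%VS.
  by apply/polyOverP=> i; rewrite coef_map memvZ ?memv_line.
have splitQ : splitting_field_axiom Q.
  exists (map_poly (in_alg Q) p) => //; exists s; last exact: genQ.
  by rewrite Fs eqpxx.
pose Qsp : splittingFieldType rat :=
  HB.pack (FieldExt.sort Q) (FieldExt_isSplittingField.Build rat Q splitQ).
have [a sa Da] : exists2 a, a \in s & x = QC a.
  by apply/mapP; rewrite Ds conjugate_refl.
have [b sb Db] : exists2 b, b \in s & y = QC b by apply/mapP; rewrite Ds.
have rb : root (minPoly 1%AS (a : Qsp)) b.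
  have /polyOver1P[q Dq] := minPolyOver 1%AS (a : Qsp).
  have: root (map_poly ratr q) x.
    rewrite -(map_poly_in_alg QC) Da fmorph_root.
    by have := root_minPoly 1%AS (a : Qsp); rewrite Dq.
  rewrite dv_p => /dvdpP[r Dr].
  rewrite Dq Dr rmorphM rootM; apply/orP; right.
  by have := sb; rewrite -root_prod_XsubC -Fs.
have [g _ Dg] := normalField_root_minPoly (sub1v {:Qsp}%AS) (normalFieldf _)
  (memvf a) rb.
have [nu Dnu] := extend_algC_subfield_aut QC (g : {rmorphism Qsp -> Qsp}).
by exists nu; rewrite Da Db -Dnu; congr (QC _).
Qed.

Lemma mem_conjugatesP (x y : algC) :
  reflect (exists nu : {rmorphism algC -> algC}, nu x = y)
          (y \in conjugates x).
Proof.
apply: (iffP idP) => [/aut_of_conjugate// | [nu <-]].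
rewrite -root_prod_XsubC -minCpoly_conjugates -(minCpoly_aut nu).
exact: root_minCpoly.
Qed.

(** The minimal polynomial is irreducible in characteristic 0, hence separable. *)
Lemma conjugates_uniq (x : algC) : uniq (conjugates x).
Proof.
rewrite -separable_prod_XsubC -minCpoly_conjugates.
have [p [Dp mon_p] dv_p] := minCpolyP x.
have szp : (1 < size p)%N.
  by have := size_minCpoly x; rewrite Dp size_map_poly.
have px : root (map_poly ratr p) x by rewrite dv_p.
have nzp := monic_neq0 mon_p.
have irr_p : irreducible_poly p.
  by apply/(subfx_irreducibleP px nzp) => q qx nzq; rewrite dvdp_leq // -dv_p.
rewrite Dp separable_map unlock /coprimep; apply: contraT => gn1.
have /(eqp_dvdl p^`()) := irr_p.2 _ gn1 (dvdp_gcdl _ _).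
rewrite dvdp_gcdr => /esym /dvdp_leq; rewrite leqNgt lt_size_deriv // => szd.
suffices /szd : p^`() != 0 by [].
have : p^`()`_(size p).-2 = (size p).-1%:R.
  rewrite coef_deriv -(subnKC szp) /= subn2.
  by have := monicP mon_p; rewrite lead_coefE -(subnKC szp) subn2 /= => ->.
by apply: contra_eq_neq => ->; rewrite coef0 eq_sym pnatr_eq0 -(subnKC szp).
Qed.

Lemma conjugates_aut (nu : {rmorphism algC -> algC}) (x z : algC) :
  z \in conjugates x -> nu z \in conjugates x.
Proof.
by case/mem_conjugatesP=> mu <-; apply/mem_conjugatesP; exists (nu \o mu).
Qed.

Lemma conjugates_conj (x z : algC) : z \in conjugates x -> z^* \in conjugates x.
Proof. exact: (conjugates_aut Num.conj). Qed.

Lemma conjugates_natM (c : nat) (x : algC) :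
  (0 < c)%N ->
  perm_eq (conjugates (c%:R * x)) [seq c%:R * z | z <- conjugates x].
Proof.
move=> c_gt0; have nzc : c%:R != 0 :> algC by rewrite pnatr_eq0 -lt0n.
apply: uniq_perm; rewrite ?(map_inj_uniq (mulfI nzc)) ?conjugates_uniq // => y.
apply/mem_conjugatesP/mapP => [[nu <-]|[z /mem_conjugatesP[nu <-] ->]].
  exists (nu x); last by rewrite rmorphM rmorph_nat.
  by apply/mem_conjugatesP; exists nu.
by exists nu; rewrite rmorphM rmorph_nat.
Qed.

Lemma conjugates_nat (c : nat) : conjugates c%:R = [:: c%:R].
Proof.
have/allP cc : {in conjugates (c%:R : algC), forall z, pred1 c%:R z}.
  by move=> z /mem_conjugatesP[nu <-] /=; rewrite rmorph_nat.
have cu := conjugates_uniq c%:R; have := conjugate_refl c%:R.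
case: (conjugates _) cc cu => [|y [|z s]] //=; first by rewrite andbT => /eqP->.
by case/and3P=> /eqP-> /eqP-> _; rewrite inE eqxx.
Qed.

(** * Integrality of products of roots *)

Lemma integralOver_Aint (x : algC) :
  integralOver (intr : int -> algC) x <-> x \in Aint.
Proof.
split=> [[p mon_p px] | /floorpP[p Dp]].
  apply: root_monic_Aint px _ _; first exact: monic_map.
  by apply/polyOverP=> i; rewrite coef_map /= intr_int.
exists p; last by rewrite -Dp root_minCpoly.
have := minCpoly_monic x.
rewrite Dp monicE lead_coef_map_inj //; last exact: intr_inj.
by rewrite -[1]/(1%:~R) eqr_int.
Qed.

(** Multiplying p(z) = 0 by b^(n-1), with b the leading coefficient and n the
    degree, gives a monic equation for b z whose coefficients are algebraic
    integers. *)
Lemma lead_coef_mul_root_Aint (p : {poly algC}) (z : algC) :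
  p \is a polyOver Aint -> root p z -> lead_coef p * z \in Aint.
Proof.
move=> Ap pz; have [->|nzp] := eqVneq p 0; first by rewrite lead_coef0 mul0r.
set b := lead_coef p; set n := (size p).-1.
have szp : size p = n.+1 by rewrite /n prednK // size_poly_gt0.
pose r := \poly_(i < n) (p`_i * b ^+ (n.-1 - i)).
have Ab : b \in Aint by apply: (polyOverP Ap).
have n_gt0 : (0 < n)%N by have := root_size_gt1 nzp pz; rewrite szp.
apply/integralOver_Aint; apply: (@integral_root_monic _ _ _ _ ('X^n + r)).
- by rewrite monicE lead_coefDl ?lead_coefXn ?size_polyXn ?ltnS ?size_poly.
- suffices E : ('X^n + r).[b * z] = b ^+ n.-1 * p.[z].
    by rewrite /root E (rootP pz) mulr0.
  rewrite hornerD hornerXn horner_poly horner_coef szp big_ord_recr /=.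
  rewrite mulrDr addrC; congr (_ + _).
    rewrite mulr_sumr; apply: eq_bigr => i _.
    rewrite exprMn -mulrA [b ^+ (_ - _) * _]mulrA -exprD subnK.
      by rewrite mulrCA.
    by rewrite -ltnS prednK.
  rewrite -/n.
  have -> : p`_n = b by [].
  by rewrite exprMn mulrA -exprSr prednK.
- apply/integral_poly => i; apply/integralOver_Aint.
  rewrite coefD coefXn coef_poly rpredD ?rpred_nat //.
  by case: ifP => // _; rewrite rpredM ?rpredX // (polyOverP Ap).
Qed.

(** Division by X - z keeps the coefficients algebraic integers: subtracting
    b X^(n-1) (X - z), with b the leading coefficient of p, lowers the degree,
    and the only new coefficient is b z. *)
Lemma Aint_divXsubC (p : {poly algC}) (z : algC) :
    p \is a polyOver Aint -> root p z ->
  exists2 q, q \is a polyOver Aint & p = q * ('X - z%:P).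
Proof.
have [n] := ubnP (size p); elim: n p => // n IHn p; rewrite ltnS => szp Ap pz.
have [->|nzp] := eqVneq p 0; first by exists 0; rewrite ?rpred0 ?mul0r.
have sz1 := root_size_gt1 nzp pz; pose b := lead_coef p.
have Ab : b \in Aint by apply: (polyOverP Ap).
pose m := b *: 'X^((size p).-2); pose r := p - m * ('X - z%:P).
have Am : m \is a polyOver Aint by rewrite polyOverZ ?rpredX ?polyOverX.
have lm : m * ('X - z%:P) = b *: 'X^((size p).-1) - (b * z) *: 'X^((size p).-2).
  rewrite /m -scalerAl mulrBr -exprSr scalerBr -(subnKC sz1) subn2 /=.
  by rewrite [_ * z%:P]mulrC mul_polyC scalerA.
have [|||q Aq Dr] := IHn r.
- apply: leq_trans szp; rewrite -[X in (_ < X)%N](prednK (ltnW sz1)) ltnS.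
  apply/leq_sizeP => j lej; rewrite coefB lm coefB !coefZ !coefXn.
  have -> : (j == (size p).-2) = false.
    by apply/negbTE; rewrite neq_ltn (leq_trans _ lej) ?orbT // -(subnKC sz1).
  rewrite mulr0 subr0; have [->|nej] := eqVneq j (size p).-1.
    by rewrite mulr1 subrr.
  rewrite mulr0 subr0 nth_default // -(prednK (ltnW sz1)).
  by rewrite ltn_neqAle eq_sym nej.
- rewrite /r rpredB // lm rpredB // polyOverZ ?rpredX ?polyOverX //.
  exact: lead_coef_mul_root_Aint.
- rewrite /root /r hornerD hornerN hornerM (rootP pz) hornerXsubC.
  by rewrite !(subrr, mulr0).
exists (q + m); first by rewrite rpredD.
by rewrite mulrDl -Dr subrK.
Qed.

Lemma coef0_prod_XsubC (c : algC) (s : seq algC) :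
  (c *: \prod_(z <- s) ('X - z%:P))`_0 = (-1) ^+ size s * (c * \prod_(z <- s) z).
Proof.
rewrite -horner_coef0 hornerZ mulrCA; congr (c * _).
elim: s => [|z s IHs]; first by rewrite !big_nil hornerE mulr1.
rewrite !big_cons hornerM hornerXsubC IHs sub0r /= exprS mulN1r !mulNr.
by rewrite mulrCA.
Qed.

(** Dividing out the roots of s one at a time leaves a polynomial over the
    algebraic integers, whose constant coefficient is the number in question up
    to sign. *)
Lemma Aint_prod_roots (c : algC) (s t : seq algC) :
    c *: \prod_(z <- s ++ t) ('X - z%:P) \is a polyOver Aint ->
  c * \prod_(z <- t) z \in Aint.
Proof.
elim: s => [|z s IHs] /= Ap.
  by have /polyOverP/(_ 0%N) := Ap; rewrite coef0_prod_XsubC rpredMsign.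
apply: IHs; have [|q Aq] := Aint_divXsubC (z := z) Ap.
  by rewrite /root big_cons hornerZ hornerM hornerXsubC subrr mul0r mulr0.
rewrite big_cons mulrC.
by rewrite scalerAl => /(mulIf (negbT (polyXsubC_eq0 z))) ->.
Qed.

(** * Values of the Mahler measure *)

(** This is the absolute value of the constant coefficient of the minimal
    polynomial. *)
Lemma zlead_norm_prod_nat (x : algC) :
  `|zlead x| * \prod_(z <- conjugates x) `|z| \is a Num.nat.
Proof.
rewrite -normr_prod -normrM natr_norm_int //.
have := congr1 (fun p : {poly algC} => p`_0) (zminpoly_factor x).
rewrite coef0_prod_XsubC coef_map /=.
move/(congr1 ( *%R ((-1) ^+ size (conjugates x)))).
rewrite mulrA -expr2 sqrr_sign mul1r => <-.
by rewrite rpredMsign intr_int.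
Qed.

Lemma mahler_nat_out (x : algC) :
  {in conjugates x, forall z, 1 <= `|z|} -> mahler x \is a Num.nat.
Proof.
move=> x_out; rewrite /mahler.
rewrite (eq_big_seq (fun z => `|z|)) ?zlead_norm_prod_nat //.
by move=> z /x_out z_ge1; rewrite max_r.
Qed.

Lemma mahler_nat_in (x : algC) :
  {in conjugates x, forall z, `|z| <= 1} -> mahler x \is a Num.nat.
Proof.
move=> x_in; rewrite /mahler big1_seq ?mulr1 ?natr_norm_int ?intr_int //.
by move=> z /andP[_ /x_in z_le1]; rewrite max_l.
Qed.

(** The minimal polynomial divides a monic integer polynomial, so its leading
    coefficient divides 1. *)
Lemma norm_zlead_Aint (x : algC) : x \in Aint -> `|zlead x| = 1 :> algC.
Proof.
move=> /integralOver_Aint[p mon_p px].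
have [r Dr] := zminpoly_dvd px.
have: lead_coef (zminpoly x) \is a GRing.unit.
  apply/unitrPr; exists (lead_coef r).
  by rewrite -lead_coefM -Dr (monicP mon_p).
rewrite qualifE /= => /orP[]/eqP->; first exact: normr1.
by rewrite rmorphN1 normrN1.
Qed.

Lemma mahler_Aint (x : algC) :
  x \in Aint -> mahler x = \prod_(z <- conjugates x) Num.max 1 `|z|.
Proof. by move=> Ax; rewrite /mahler norm_zlead_Aint ?mul1r. Qed.

Lemma mahler_nat (c : nat) : mahler c%:R = (maxn 1 c)%:R.
Proof.
rewrite mahler_Aint ?Aint_Cnat // conjugates_nat big_seq1 normr_nat.
rewrite /maxn; case: ltnP => lec; first by rewrite max_r ?ler1n // ltnW.
by rewrite max_l // -[1]/(1%:R) ler_nat.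
Qed.

(** * Preperiodic points *)

Section Preperiodic.

Variables (T : eqType) (f : T -> T).

Lemma preperiodic_fix (x : T) : f x = x -> preperiodic f x.
Proof.
move=> fx; exists [:: x] => n.
by rewrite inE; elim: n => //= n /eqP->; rewrite fx.
Qed.

Lemma preperiodic_next (x : T) : preperiodic f (f x) -> preperiodic f x.
Proof.
case=> s fs; exists (x :: s) => -[|n]; rewrite inE ?eqxx //.
by rewrite iterSr fs orbT.
Qed.

End Preperiodic.

Lemma preperiodic_nat (x : algC) : x \is a Num.nat -> preperiodic mahler x.
Proof.
case/natrP=> c ->; apply/preperiodic_next/preperiodic_fix.
by rewrite !mahler_nat maxnA.
Qed.

Lemma preperiodic_all_in_or_out (x : algC) :
    {in conjugates x, forall z, `|z| <= 1} \/
    {in conjugates x, forall z, 1 <= `|z|} ->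
  preperiodic mahler x.
Proof.
case=> Hx; apply/preperiodic_next/preperiodic_nat.
  exact: mahler_nat_in.
exact: mahler_nat_out.
Qed.

(** * Orbits of integer multiples of an algebraic integer *)

Lemma ge1_of_sqr (r : algC) (m : nat) :
  (0 < m)%N -> 0 <= r -> m%:R <= r ^+ 2 -> 1 <= r.
Proof.
move=> m_gt0 r_ge0 mr; rewrite -(@ler_pXn2r _ 2%N) ?nnegrE ?expr1n ?ler01 //.
by apply: le_trans mr; rewrite ler1n.
Qed.

(** If some conjugate of g lies inside the unit disc, it can only be g'.  The
    orbit of g then stays among the integer multiples c g, with c nondecreasing,
    until it becomes constant or c |g'| reaches 1; from there the next term is a
    natural number, as all conjugates of c g have modulus at least 1. *)
Lemma preperiodic_reciprocal (g g' : algC) (m : nat) :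
    g \in Aint -> 0 < g -> (0 < m)%N -> `|g * g'| = m%:R -> m%:R < g ^+ 2 ->
    {in conjugates g, forall z, [\/ z = g, z = g' | `|z| ^+ 2 = m%:R]} ->
  preperiodic mahler g.
Proof.
move=> Ag g_gt0 m_gt0 gg' g_big cg.
have ng : `|g| = g by rewrite gtr0_norm.
have g_ge1 : 1 <= g by apply: (ge1_of_sqr m_gt0); rewrite ltW.
have [/allP out|/allPn[z zg]] :=
    boolP (all (fun z => 1 <= `|z|) (conjugates g)).
  by apply: preperiodic_all_in_or_out; right.
rewrite -real_ltNge ?real1 ?normr_real // => z_lt1.
have Dz : z = g'.
  case: (cg z zg) => [zE | // | zm].
    by move: z_lt1; rewrite zE ng real_ltNge ?real1 ?gtr0_real // g_ge1.
  have := ge1_of_sqr m_gt0 (normr_ge0 z); rewrite zm lexx => /(_ isT).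
  by rewrite real_leNgt ?real1 ?normr_real // z_lt1.
rewrite {z}Dz in zg z_lt1.
have g'_neq0 : g' != 0.
  apply: contraTneq m_gt0 => g'0; move: gg'; rewrite g'0 mulr0 normr0.
  by move/esym/eqP; rewrite pnatr_eq0 => /eqP->.
have gNg' : g != g'.
  by apply: contraTneq z_lt1 => <-; rewrite ng -real_leNgt ?real1 ?gtr0_real.
set t := rem g' (rem g (conjugates g)).
have conjE : perm_eq (conjugates g) [:: g, g' & t].
  rewrite (perm_trans (perm_to_rem (conjugate_refl g))) // perm_cons.
  by apply: perm_to_rem; rewrite mem_rem_uniq ?conjugates_uniq // inE eq_sym gNg'.
have t_norm z : z \in t -> `|z| = sqrtC m%:R.
  have ug := conjugates_uniq g.
  rewrite mem_rem_uniq ?rem_uniq // inE mem_rem_uniq // inE.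
  case/and3P=> zg' zNg gz.
  have [/eqP | /eqP | <-] := cg z gz; rewrite ?(negPf zg') ?(negPf zNg) //.
  by rewrite exprCK.
set N := sqrtC m%:R in t_norm; pose k := size t.
have NE : N ^+ 2 = m%:R by rewrite sqrtCK.
have N_ge0 : 0 <= N by rewrite sqrtC_ge0 ler0n.
have N_ge1 : 1 <= N by apply: (ge1_of_sqr m_gt0); rewrite ?NE.
(* N^k is rational because m * N^k is the absolute value of the norm of g. *)
have [C C_gt0 NkE] : exists2 C, (0 < C)%N & N ^+ k = C%:R.
  have Ck_ge1 : 1 <= N ^+ k by rewrite exprn_ege1.
  suffices /natrP[C CE] : N ^+ k \is a Num.nat.
    by exists C; rewrite // -(ltr0n algC) -CE (lt_le_trans ltr01).
  rewrite natrEint exprn_ge0 // andbT Cint_rat_Aint //; last first.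
    apply: rpredX; apply: (@root_monic_Aint ('X^2 - m%:R%:P)).
    + by rewrite /root !hornerE NE subrr.
    + exact: monicXnsubC.
    + apply/polyOverP=> i; rewrite coefB coefXn coefC rpredB ?rpred_nat //.
      by case: ifP => _; rewrite ?rpred_nat ?rpred0.
  have := zlead_norm_prod_nat g; rewrite norm_zlead_Aint // mul1r.
  rewrite (perm_big _ conjE) !big_cons /=.
  rewrite mulrA -normrM gg' (eq_big_seq _ t_norm) big_const_seq count_predT.
  rewrite iter_mulr_1 -/k => /natrP[c cE].
  have -> : N ^+ k = c%:R / m%:R.
    by rewrite -cE mulrAC divff ?mul1r // pnatr_eq0 -lt0n.
  by rewrite rpred_div ?rpred_nat.
have mahlerM c : (0 < c)%N ->
    mahler (c%:R * g) = (c ^ k.+1 * C)%:R * g * Num.max 1 (c%:R * `|g'|).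
  move=> c_gt0; have c_ge1 : 1 <= c%:R :> algC by rewrite ler1n.
  rewrite mahler_Aint ?rpredM ?rpred_nat // (perm_big _ (conjugates_natM g c_gt0)).
  rewrite big_map (perm_big _ conjE) !big_cons /= normrM normr_nat ng.
  rewrite max_r ?mulr_ege1 // normrM normr_nat.
  rewrite (eq_big_seq (fun=> c%:R * N)) /=; last first.
    by move=> z /t_norm zN; rewrite normrM normr_nat zN max_r ?mulr_ege1.
  rewrite big_const_seq count_predT iter_mulr_1 -/k exprMn NkE.
  rewrite expnS !natrM natrX -!mulrA; congr (_ * _).
  by rewrite [RHS]mulrA [RHS]mulrC -mulrA.
have g'_gt0 : 0 < `|g'| by rewrite normr_gt0.
pose B := Num.bound (`|g'|^-1).
have B_big c : (B <= c)%N -> 1 <= c%:R * `|g'|.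
  move=> Bc; rewrite -ler_pdivrMr // div1r.
  apply: (le_trans (ltW (archi_boundP _))); first by rewrite invr_ge0 ltW.
  by rewrite ler_nat.
have out c : (0 < c)%N -> 1 <= c%:R * `|g'| -> preperiodic mahler (c%:R * g).
  move=> c_gt0 c_out; apply: preperiodic_all_in_or_out; right.
  have c_ge1 : 1 <= c%:R :> algC by rewrite ler1n.
  move=> y; rewrite (perm_mem (conjugates_natM g c_gt0)) => /mapP[z + ->].
  rewrite (perm_mem conjE) normrM normr_nat !inE.
  case/or3P=> [/eqP-> | /eqP-> // | /t_norm->].
    by rewrite ng mulr_ege1.
  exact: mulr_ege1.
(* From B on, c * |g'| >= 1; so B - c bounds the number of increases of c. *)
suffices orbit n c : (0 < c)%N -> (B <= c + n)%N -> preperiodic mahler (c%:R * g).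
  by have := orbit B 1%N isT (leq_addl _ _); rewrite mul1r.
elim: n c => [|n IHn] c c_gt0 Bcn.
  by rewrite addn0 in Bcn; apply: out (B_big _ Bcn).
have [/(out c c_gt0) // |c_in] := boolP (1 <= c%:R * `|g'|).
have c_max : Num.max 1 (c%:R * `|g'|) = 1.
  by apply/max_l/ltW; rewrite real_ltNge ?real1 ?rpredM ?normr_real ?realn.
have : (c <= c ^ k.+1 * C)%N.
  by rewrite expnS -mulnA leq_pmulr // muln_gt0 expn_gt0 c_gt0.
rewrite leq_eqVlt => /orP[/eqP cE|c_lt].
  by apply: preperiodic_fix; rewrite mahlerM // c_max mulr1 -cE.
apply: preperiodic_next; rewrite mahlerM // c_max mulr1; apply: IHn.
  exact: leq_trans c_lt.
by rewrite (leq_trans Bcn) // addnS ltn_add2r.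
Qed.

(** * Numbers with conjugates on both sides of the unit circle *)

Lemma zlead_prod_Aint (x : algC) (s t : seq algC) :
  perm_eq (conjugates x) (s ++ t) -> zlead x * \prod_(z <- t) z \in Aint.
Proof.
move=> st; apply: (@Aint_prod_roots _ s); rewrite -(perm_big _ st) /=.
rewrite -zminpoly_factor; apply/polyOverP=> i.
by rewrite coef_map /= Aint_int.
Qed.

(** Here M(x) = |P|, and [preperiodic_reciprocal] applies to g = |P| = e P and
    g' = e P', where e is the sign of the real number P. *)
Lemma preperiodic_split (x : algC) (s t : seq algC) :
    let P := zlead x * \prod_(z <- s) z in
    let P' := zlead x * \prod_(z <- t) z in
    perm_eq (conjugates x) (s ++ t) -> s != [::] ->
    {in s, forall z, 1 < `|z|} -> {in t, forall z, `|z| <= 1} ->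
    P \is Num.real ->
    (forall nu : {rmorphism algC -> algC},
       [\/ nu P = P, nu P = P' | `|nu P| ^+ 2 = `|P * P'|]) ->
  preperiodic mahler x.
Proof.
move=> P P' st s_n0 s_out t_in realP nuP.
have mahlerE : mahler x = `|P|.
  rewrite /mahler (perm_big _ st) big_cat /= [X in _ * (_ * X)]big1_seq.
    rewrite mulr1 normrM normr_prod; congr (_ * _).
    by apply: eq_big_seq => z /s_out z_gt1; rewrite max_r ?ltW.
  by move=> z /andP[_ /t_in z_le1]; rewrite max_l.
have [y ys] : exists y, y \in s.
  by case: (s) s_n0 => [//|y s' _]; exists y; rewrite mem_head.
have y_out := s_out y ys.
have x_n0 : x != 0.
  have /mem_conjugatesP[nu nuy] : y \in conjugates x.
    by rewrite (perm_mem st) mem_cat ys.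
  by apply: contraTneq y_out => x0; rewrite -nuy x0 rmorph0 normr0 ltr10.
have st_n0 z : z \in s ++ t -> z != 0.
  by rewrite -(perm_mem st) => /mem_conjugatesP[nu <-]; rewrite fmorph_eq0.
have zl_n0 : zlead x != 0 :> algC by rewrite intr_eq0 lead_coef_eq0 zminpoly_neq0.
have AP : P \in Aint.
  by apply: (@zlead_prod_Aint _ t); rewrite (perm_trans st) // perm_catC.
have P_n0 : P != 0.
  rewrite mulf_neq0 // prodf_seq_neq0; apply/allP => z zs; rewrite st_n0 //.
  by rewrite mem_cat zs.
have P'_n0 : P' != 0.
  rewrite mulf_neq0 // prodf_seq_neq0; apply/allP => z zt; rewrite st_n0 //.
  by rewrite mem_cat zt orbT.
have /natrP[m PP'm] : `|P * P'| \is a Num.nat.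
  have -> : P * P' = zlead x * (zlead x * \prod_(z <- conjugates x) z).
    by rewrite (perm_big _ st) big_cat /= mulrACA -mulrA.
  rewrite !normrM normr_prod.
  by rewrite rpredM ?zlead_norm_prod_nat // natr_norm_int ?intr_int.
have ltP'P : `|P'| < `|P|.
  rewrite !normrM ltr_pM2l ?normr_gt0 // !normr_prod.
  apply: (@le_lt_trans _ _ 1).
    by rewrite big_seq prodr_ile1 // => z /t_in->; rewrite normr_ge0.
  rewrite (perm_big _ (perm_to_rem ys)) big_cons /=.
  apply: lt_le_trans y_out (ler_peMr (normr_ge0 _) _).
  rewrite big_seq; elim/big_ind: _ => [//|u v|z /mem_rem/s_out/ltW //].
  exact: mulr_ege1.
pose e : algC := (-1) ^+ (P < 0)%R.
have PE : `|P| = e * P by rewrite (real_normrEsign realP).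
have ne : `|e| = 1 by rewrite normr_sign.
apply: preperiodic_next; rewrite mahlerE.
apply: (@preperiodic_reciprocal _ (e * P') m).
- by rewrite PE rpredMsign.
- by rewrite normr_gt0.
- by rewrite -(ltr0n algC) -PP'm normr_gt0 mulf_neq0.
- by rewrite normrM normr_id (normrM e P') ne mul1r -normrM.
- by rewrite -PP'm (normrM P) expr2 ltr_pM2l ?normr_gt0.
move=> z /mem_conjugatesP[nu <-]; rewrite PE rmorphM rmorph_sign.
have [-> | -> | nuE] := nuP nu; [by constructor 1 | by constructor 2 |].
constructor 3.
by rewrite (normrM e) ne mul1r nuE PP'm.
Qed.

Lemma norm_dichotomy (z : algC) : (1 < `|z|) || (`|z| <= 1).
Proof. by case: real_ltgtP; rewrite ?real1 ?normr_real. Qed.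

Lemma aut_zlead (nu : {rmorphism algC -> algC}) (x y : algC) :
  nu (zlead x * y) = zlead x * nu y.
Proof. by rewrite rmorphM rmorph_int. Qed.

(** The outer conjugate is real, because its complex conjugate is a conjugate of
    x of the same modulus. *)
Lemma preperiodic_deg2_split (x z1 z2 : algC) :
    perm_eq (conjugates x) [:: z1; z2] -> 1 < `|z1| -> `|z2| <= 1 ->
  preperiodic mahler x.
Proof.
move=> st z1_out z2_in.
have z1x : z1 \in conjugates x by rewrite (perm_mem st) mem_head.
apply: (@preperiodic_split x [:: z1] [:: z2]) => //;
  try by move=> z /[!inE]/eqP->.
  rewrite big_seq1 rpredM ?realz // CrealE.
  have := conjugates_conj z1x; rewrite (perm_mem st) !inE => /orP[//|/eqP z12].
  by move: z2_in; rewrite -z12 norm_conjC real_leNgt ?real1 ?normr_real // z1_out.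
move=> nu; rewrite !big_seq1 aut_zlead.
have := conjugates_aut nu z1x; rewrite (perm_mem st) !inE.
by case/orP=> /eqP->; [constructor 1 | constructor 2].
Qed.

Lemma preperiodic_deg2 (x : algC) :
  size (conjugates x) = 2%N -> preperiodic mahler x.
Proof.
case E: (conjugates x) => [|z1 [|z2 []]] // _.
have [o1|i1] := orP (norm_dichotomy z1); have [o2|i2] := orP (norm_dichotomy z2).
- apply: preperiodic_all_in_or_out; right => z; rewrite E !inE.
  by case/orP=> /eqP->; apply: ltW.
- by apply: (@preperiodic_deg2_split x z1 z2); rewrite // E.
- apply: (@preperiodic_deg2_split x z2 z1) => //.
  by rewrite E (perm_catC [:: z1] [:: z2]).
- apply: preperiodic_all_in_or_out; left => z; rewrite E !inE.
  by case/orP=> /eqP->.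
Qed.

Lemma preperiodic_deg1 (x : algC) :
  size (conjugates x) = 1%N -> preperiodic mahler x.
Proof.
case E: (conjugates x) => [|z []] // _; apply: preperiodic_all_in_or_out.
have [o|i] := orP (norm_dichotomy z); [right | left] => y; rewrite E inE => /eqP-> //.
exact: ltW.
Qed.

(** An automorphism sends the pair of a and its complex conjugate to one of the
    two conjugate pairs, or to one number of each; in the last case the square of
    the modulus of the image of P is |P P'|, where P and P' are the two products of
    [preperiodic_split]. *)
Lemma preperiodic_deg4_split (x a b : algC) :
    perm_eq (conjugates x) [:: a; a^*; b; b^*] -> 1 < `|a| -> `|b| <= 1 ->
  preperiodic mahler x.
Proof.
move=> st a_out b_in.
have ux : uniq [:: a; a^*; b; b^*] by rewrite -(perm_uniq st) conjugates_uniq.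
have ax : a \in conjugates x by rewrite (perm_mem st) mem_head.
have a'x := conjugates_conj ax.
apply: (@preperiodic_split x [:: a; a^*] [:: b; b^*]) => //.
- by move=> z /[!inE]/orP[]/eqP->; rewrite ?norm_conjC.
- by move=> z /[!inE]/orP[]/eqP->; rewrite ?norm_conjC.
- rewrite big_cons big_seq1 -normCK rpredM ?realz // rpredX ?normr_real //.
move=> nu; rewrite !big_cons !big_nil !mulr1 aut_zlead rmorphM.
have nuN : nu a != nu a^*.
  rewrite (inj_eq (fmorph_inj nu)).
  by move: ux; rewrite /= inE negb_or -andbA => /andP[].
pose P : algC := zlead x * (a * a^*).
pose P' : algC := zlead x * (b * b^*).
pose expected u v := let w := zlead x * (u * v) in
  [\/ w = P, w = P' | `|w| ^+ 2 = `|P * P'|].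
have expectedC u v : expected v u -> expected u v by rewrite /expected (mulrC v).
have mixed u v : `|u| = `|a| -> `|v| = `|b| -> expected u v.
  move=> ua vb; constructor 3; rewrite !normrM !norm_conjC ua vb expr2.
  by rewrite mulrACA [RHS]mulrACA; congr (_ * _); rewrite mulrACA.
have aa' : expected a a^* by constructor 1.
have bb' : expected b b^* by constructor 2.
have := conjugates_aut nu a'x; have := conjugates_aut nu ax.
rewrite !(perm_mem st) !inE -/(expected _ _) => nu_a nu_a'.
case/or4P: nu_a nuN => /eqP->; case/or4P: nu_a' => /eqP->;
  rewrite ?eqxx // => _.
all: first [exact: expectedC | by apply: mixed; rewrite ?norm_conjC
  | by apply/expectedC/mixed; rewrite ?norm_conjC].
Qed.

Lemma conjugate_pairs (x : algC) :
    size (conjugates x) = 4%N -> {in conjugates x, forall z, z^* != z} ->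
  exists a b, perm_eq (conjugates x) [:: a; a^*; b; b^*].
Proof.
move=> sz4 nreal; have xx := conjugate_refl x; have x'x := conjugates_conj xx.
have [/allP sub2|/allPn[b bx]] :=
    boolP (all (mem [:: x; x^*]) (conjugates x)).
  by have := uniq_leq_size (conjugates_uniq x) sub2; rewrite sz4.
rewrite !inE negb_or => /andP[bNx bNx'].
have b'x := conjugates_conj bx.
have u4 : uniq [:: x; x^*; b; b^*].
  rewrite /= !inE !negb_or (eq_sym x x^*) nreal // (eq_sym x b) bNx.
  rewrite (eq_sym x^* b) bNx'.
  rewrite (inj_eq (fmorph_inj _)) (eq_sym x b) bNx (eq_sym b b^*).
  rewrite nreal // !andbT /=.
  by apply: contraNneq bNx' => ->; rewrite conjCK.
exists x, b; rewrite perm_sym; apply: uniq_perm (conjugates_uniq x) _ => //.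
apply: (uniq_min_size u4 _ _).2; last by rewrite sz4.
by apply/allP; rewrite /= xx x'x bx b'x.
Qed.

Lemma preperiodic_deg4 (x : algC) :
    size (conjugates x) = 4%N -> {in conjugates x, forall z, z^* != z} ->
  preperiodic mahler x.
Proof.
move=> sz4 /(conjugate_pairs sz4)[a [b st]].
have [oa|ia] := orP (norm_dichotomy a); have [ob|ib] := orP (norm_dichotomy b).
- apply: preperiodic_all_in_or_out; right => z; rewrite (perm_mem st) !inE.
  by case/or4P=> /eqP->; rewrite ?norm_conjC ltW.
- exact: preperiodic_deg4_split st _ _.
- apply: (@preperiodic_deg4_split x b a) => //.
  by rewrite (perm_trans st) ?(perm_catC [:: a; a^*]).
- apply: preperiodic_all_in_or_out; left => z; rewrite (perm_mem st) !inE.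
  by case/or4P=> /eqP->; rewrite ?norm_conjC.
Qed.

(** * Conjugates of elements of a number field *)

Section NumberField.

Variables (K : fieldExtType rat) (iota : {rmorphism K -> algC}).

Lemma size_conjugates (x : K) : size (conjugates (iota x)) = \dim <<1; x>>.
Proof.
have [p [Dp mon_p] dv_p] := minCpolyP (iota x).
have -> : size (conjugates (iota x)) = (size p).-1.
  rewrite -(size_map_poly (ratr : {rmorphism rat -> algC})) -Dp.
  by rewrite minCpoly_conjugates size_prod_XsubC.
have /polyOver1P[q Dq] := minPolyOver 1%AS x.
have szq : size q = (adjoin_degree 1%AS x).+1.
  by rewrite -(size_map_poly (in_alg K)) -Dq size_minPoly.
have pq : p %= q.
  apply/andP; split.
    rewrite -dv_p -(map_poly_in_alg iota) fmorph_root -Dq; exact: root_minPoly.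
  rewrite -(dvdp_map (in_alg K)) -Dq; apply: minPoly_dvdp.
    by apply/polyOver1P; exists p.
  by rewrite -(fmorph_root iota) map_poly_in_alg dv_p.
by rewrite (eqp_size pq) szq /= adjoin_degreeE dimv1 divn1.
Qed.

(** A real conjugate nu (iota x) of a generator x would give a real embedding
    nu \o iota, as every element of K is a rational polynomial in x. *)
Lemma totally_imaginary_conjugates (x : K) :
    totally_imaginary K -> <<1; x>>%VS = fullv ->
  {in conjugates (iota x), forall z, z^* != z}.
Proof.
move=> imK genx z /mem_conjugatesP[nu <-]; apply/eqP => z_real.
apply: (imK (nu \o iota)) => y /=.
have y_x : y \in <<1%AS; x>>%VS by rewrite genx memvf.
rewrite -(Fadjoin_poly_eq y_x).
have /polyOver1P[q ->] := Fadjoin_polyOver 1%AS x y.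
rewrite -[nu _]/((nu \o iota) _) -horner_map map_poly_in_alg /=.
rewrite CrealE -horner_map /= z_real -map_poly_comp; apply/eqP; congr _.[_].
by apply: eq_map_poly => a /=; rewrite fmorph_rat.
Qed.

End NumberField.

Theorem proposition3p2 (K : fieldExtType rat) (iota : {rmorphism K -> algC}) :
  \dim {:K} = 4%N -> totally_imaginary K ->
  forall x : K, preperiodic mahler (iota x).
Proof.
move=> dimK imK x; have := field_dimS (subvf <<1; x>>%AS).
rewrite dimK -(size_conjugates iota) => dv4.
have : size (conjugates (iota x)) \in [:: 1; 2; 4]%N.
  by rewrite -[[:: 1; _; _]%N]/(divisors 4) -dvdn_divisors.
rewrite !inE => /or3P[]/eqP sz.
- exact: preperiodic_deg1.
- exact: preperiodic_deg2.
apply: (preperiodic_deg4 sz); apply: totally_imaginary_conjugates => //.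
by apply/eqP; rewrite eqEdim subvf dimK -(size_conjugates iota) sz.
Qed.
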